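(* Let $q\ge5$ be an odd prime power and let $p$ be the prime dividing $q$. Let $G=\mathrm{SL}(2,q)$, let $t=-I\in G$, and let $S$ be the set of elements of $G$ of order $p$ or $2p$. Then the graph $\mathrm{Cay}(G,\{t\}\cup S)$ is not a Cayley graph of any abelian group.
   Context: For a group $G$ and an inverse-closed subset $C\subseteq G\setminus\{1_G\}$, $\mathrm{Cay}(G,C)$ is the graph with vertex set $G$ in which $g\sim h$ if and only if $hg^{-1}\in C$. A graph $X$ is a Cayley graph of a group $K$ if $X\cong\mathrm{Cay}(K,C')$ for some inverse-closed $C'\subseteq K\setminus\{1_K\}$; equivalently, $\mathrm{Aut}(X)$ contains a regular subgroup isomorphic to $K$. *)

(* Defs.v *)
From HB Require Import structures.
From mathcomp Require Import all_boot all_order all_fingroup all_algebra.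

Set Implicit Arguments.
Unset Strict Implicit.
Unset Printing Implicit Defensive.

Import GroupScope GRing.Theory.

Definition graph_iso (V W : Type) (e : rel V) (f : rel W) : Prop :=
  exists2 phi : V -> W, bijective phi & forall x y, f (phi x) (phi y) = e x y.

Section CayleyGraph.
Variable K : groupType.

Definition connection_set (C : {pred K}) : Prop :=
  1 \notin C /\ {in C, forall x, x^-1 \in C}.

Definition Cay (C : {pred K}) : rel K := [rel g h | h * g^-1 \in C].

(* K is an arbitrary, possibly infinite, group. *)
Definition Cayley_graph_of (V : Type) (e : rel V) : Prop :=
  exists2 C : {pred K}, connection_set C & graph_iso e (Cay C).

End CayleyGraph.

Section SpecialLinear.
Variables (n : nat) (R : finComUnitRingType).

Definition SLset : {set {'GL_n[R]}} := [set u | (\det (GLval u) == 1)%R].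

Lemma SL_group_set : group_set SLset.
Proof.
apply/group_setP; split=> [|u v]; rewrite !inE ?GL_1E ?det1 //.
by move=> /eqP du /eqP dv; rewrite GL_ME det_mulmx du dv mulr1.
Qed.
Canonical SLgroup := Group SL_group_set.

End SpecialLinear.

Notation "{ ''SL_' n [ R ] }" := (subg_of (SLgroup n R))
  (n at level 2, format "{ ''SL_' n [ R ] }") : type_scope.

Section MinusIdentity.
Variable R : finComUnitRingType.

Definition GL2_opp1 : {'GL_2[R]} :=
  FinRing.unit _ (unitrN1 'M[R]_2 : (-1 : 'M[R]_2)%R \is a GRing.unit).

Lemma GL2_opp1_SL : GL2_opp1 \in SLgroup 2 R.
Proof.
rewrite inE /GLval /= -scaleN1r detZ det1 mulr1 /=.
by rewrite -signr_odd expr0.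
Qed.

Definition SL2_opp1 : {'SL_2[R]} := Subg GL2_opp1_SL.

Lemma SL2_opp1E : GLval (val SL2_opp1) = (- 1%:M)%R.
Proof. by []. Qed.

End MinusIdentity.

Definition SL2_order_p_2p (R : finComUnitRingType) (p : nat) :
    {set {'SL_2[R]}} :=
  [set x | (#[x] == p) || (#[x] == 2 * p)%N].

Lemma connection_set_SL2 (R : finComUnitRingType) (p : nat) :
  prime p -> (1 + 1 != 0 :> R)%R ->
  connection_set (SL2_opp1 R |: SL2_order_p_2p R p).
Proof.
move=> p_pr two_neq0; have p_gt1 := prime_gt1 p_pr; split=> [|x].
  rewrite !inE order1 !negb_or; apply/and3P; split.
  - apply: contraNneq two_neq0 => /(congr1 (fun u => GLval (val u) ord0 ord0)).
    rewrite SL2_opp1E !mxE /= => one_opp.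
    by apply/eqP; rewrite -[X in (X + _)%R]/(1%R *+ true)%R one_opp addNr.
  - by rewrite neq_ltn p_gt1.
  - by rewrite neq_ltn; case: p p_gt1 {p_pr} => [|[]].
rewrite !inE orderV => /orP[/eqP-> | ->]; last by rewrite orbT.
apply/orP; left; rewrite -(inj_eq val_inj) -(inj_eq val_inj) /=.
by rewrite -[X in X == _]/((-1 : 'M[R]_2)^-1)%R invrN1.
Qed.

(* Main.v *)
(* Since S together with 1 and t = -I is the set E of elements of trace 2 or -2,
   the closed adjacency matrix is N = [tr (y x^-1) = 2 or -2]. Over F itself,
   that is modulo p, a count of transvections gives N^2 = 4 D and N D = 2 D, where
   D(x, y) counts the vectors z with z and x y^-1 z proportional. Hence every
   power N^m with m >= 2 is a nonzero multiple of D, and D does not vanish at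
   nonadjacent x, y because x y^-1 has 0 or 2 fixed points on the projective line.
   If an abelian group K acts regularly on the graph, N is a sum of
   commuting permutation matrices, so by Frobenius N^q is the sum of their q-th
   powers. Thus every vertex not adjacent to 1 is the image of 1 under a q-th
   power in a group isomorphic to K. There are at most q^2 - 1 such powers, as
   |K| = q (q^2 - 1), but at least q (q^2 - 1) - 2 q^2 such vertices; this is a
   contradiction for q >= 5. *)
Require Import Defs.
From mathcomp Require Import all_boot all_order all_fingroup all_algebra.
From mathcomp Require Import all_solvable finfield ring zify.

Set Implicit Arguments.
Unset Strict Implicit.
Unset Printing Implicit Defensive.

Import GroupScope GRing.Theory.

(** * Two-by-two matrices in coordinates *)

Section TwoByTwo.
Local Open Scope ring_scope.
Variable R : comNzRingType.
Implicit Types A B : 'M[R]_2.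

Lemma sum_ord2 (V : nmodType) (f : 'I_2 -> V) : \sum_i f i = f 0 + f 1.
Proof. by rewrite big_ord_recl big_ord1; congr (_ + f _); apply: val_inj. Qed.

Lemma matrix2P A B :
  A 0 0 = B 0 0 -> A 0 1 = B 0 1 -> A 1 0 = B 1 0 -> A 1 1 = B 1 1 -> A = B.
Proof.
move=> e00 e01 e10 e11; apply/matrixP => i j.
have ord2 (l : 'I_2) : l = 0 \/ l = 1.
  by case: l => [[|[|//]] ?]; [left|right]; apply: val_inj.
by case: (ord2 i) => ->; case: (ord2 j) => ->.
Qed.

Lemma mulmx2E A B i j : (A *m B) i j = A i 0 * B 0 j + A i 1 * B 1 j.
Proof. by rewrite mxE sum_ord2. Qed.

Lemma mxtrace2E A : \tr A = A 0 0 + A 1 1.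
Proof. exact: sum_ord2. Qed.

Lemma det2E A : \det A = A 0 0 * A 1 1 - A 0 1 * A 1 0.
Proof.
rewrite (expand_det_row _ 0) sum_ord2 /cofactor !det_mx11 !mxE /=.
have -> : lift 0 0 = 1 :> 'I_2 by apply: val_inj.
have -> : lift 1 0 = 0 :> 'I_2 by apply: val_inj.
by rewrite expr0 expr1 mul1r mulN1r mulrN.
Qed.

Definition mx2 (a b c d : R) : 'M[R]_2 :=
  \matrix_(i, j) if i == 0 then (if j == 0 then a else b)
                 else (if j == 0 then c else d).

Lemma mx2E a b c d :
  ((mx2 a b c d 0 0 = a) * (mx2 a b c d 0 1 = b))
  * ((mx2 a b c d 1 0 = c) * (mx2 a b c d 1 1 = d)).
Proof. by rewrite !mxE. Qed.

Lemma mx2_eta A : mx2 (A 0 0) (A 0 1) (A 1 0) (A 1 1) = A.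
Proof. by apply: matrix2P; rewrite mx2E. Qed.

(** Cayley-Hamilton in dimension two. *)
Lemma sqr_mx2 A : A *m A = \tr A *: A - (\det A)%:M.
Proof.
by rewrite mxtrace2E det2E; apply: matrix2P; rewrite mulmx2E !mxE /=; ring.
Qed.

End TwoByTwo.

(* [fixform A x y] is the determinant of the pair (z, A z) for z = (x, y), so
   its zeros are the eigenvectors of A together with 0. *)
Definition fixform (R : pzRingType) (A : 'M[R]_2) (x y : R) : R :=
  (A 1 0 * x * x + (A 1 1 - A 0 0) * x * y - A 0 1 * y * y)%R.

(** The map w -> w + l det(z, w) z, where z = (x, y). *)
Definition transvection2 (R : comNzRingType) (x y l : R) : 'M[R]_2 :=
  (mx2 (1 - l * x * y) (l * x * x) (- (l * y * y)) (1 + l * x * y))%R.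

(* If A has m fixed points on the projective line, this is
   1 + (q - 1) m = 1 - m in F. *)
Definition eigcount (F : finFieldType) (A : 'M[F]_2) : F :=
  (\sum_x \sum_y (fixform A x y == 0)%:R)%R.

Definition parabolic (F : finFieldType) (A : 'M[F]_2) : bool :=
  ((\tr A == 2) || (\tr A == - 2))%R.

(** * Point counts over [F], taken in [F] itself *)

Section Counting.
Local Open Scope ring_scope.
Variable F : finFieldType.
Implicit Types A B : 'M[F]_2.

(** Translation by 1 permutes F, so adding |F| does not change the sum of all elements. *)
Lemma natr_card_field : #|F|%:R = 0 :> F.
Proof.
have shift : \sum_(x : F) x = \sum_(x : F) x + #|F|%:R :> F.
  rewrite {1}(reindex_inj (addIr 1)) big_split /=; congr (_ + _).
  by rewrite sumr_const.
by rewrite -[RHS](subrr (\sum_(x : F) x)) {1}shift addrAC subrr add0r.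
Qed.

Lemma sumr_const_field (a : F) : \sum_(x : F) a = 0.
Proof. by rewrite sumr_const -mulr_natr natr_card_field mulr0. Qed.

Lemma sum_eq_pred (a : F) : \sum_x (x == a)%:R = 1 :> F.
Proof.
rewrite (bigD1 a) //= eqxx big1 ?addr0 // => x /negPf-> //.
Qed.

(** One solution for nonzero b; otherwise 0 or |F| of them, which is 0 in [F]. *)
Lemma sum_linear_eq (a b s : F) :
  \sum_l (a + l * b == s)%:R = (b != 0)%:R :> F.
Proof.
have [-> | b0] /= := eqVneq b 0.
  by under eq_bigr do rewrite mulr0 addr0; rewrite sumr_const_field.
rewrite -[RHS](sum_eq_pred ((s - a) / b)).
apply: eq_bigr => l _; congr (nat_of_bool _)%:R.
by rewrite -[RHS](inj_eq (mulIf b0)) divfK // -[in RHS](inj_eq (addrI a)) subrKC.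
Qed.

Lemma sumr_neq (I : finType) (P : pred I) :
  \sum_i (~~ P i)%:R = #|I|%:R - \sum_i (P i)%:R :> F.
Proof.
apply/eqP; rewrite eq_sym subr_eq -big_split /= -[#|I|]sum1_card natr_sum.
by apply/eqP; apply: eq_bigr => i _; case: (P i); rewrite ?addr0 ?add0r.
Qed.

Lemma sumr_negb_field (P : pred F) :
  \sum_i (~~ P i)%:R = - \sum_i (P i)%:R :> F.
Proof. by rewrite sumr_neq natr_card_field sub0r. Qed.

Lemma sumr_negb_field2 (P : F -> F -> bool) :
  \sum_x \sum_y (~~ P x y)%:R = - \sum_x \sum_y (P x y)%:R :> F.
Proof.
by rewrite -sumrN; apply: eq_bigr => x _; rewrite sumr_negb_field.
Qed.

Lemma transvection2_det x y l : \det (transvection2 x y l : 'M[F]_2) = 1.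
Proof. by rewrite det2E !mx2E; ring. Qed.

Lemma transvection2_tr x y l : \tr (transvection2 x y l : 'M[F]_2) = 2.
Proof. by rewrite mxtrace2E !mx2E; ring. Qed.

Lemma transvection2_mul_tr x y l A :
  \tr (transvection2 x y l *m A) = \tr A + l * fixform A x y.
Proof.
by rewrite !mxtrace2E !mulmx2E !mx2E /fixform; ring.
Qed.

(** With z = (x, y) and w = (a, b), the transvection adds l det(z, A w) z to A w; pairing with w
    brings in the factor det(z, w). *)
Lemma fixform_transvection2_mul x y l A a b :
  fixform (transvection2 x y l *m A) a b =
  fixform A a b - l * ((x * b - y * a) *
       (x * (A 1 0 * a + A 1 1 * b) - y * (A 0 0 * a + A 0 1 * b))).
Proof.
by rewrite /fixform !mulmx2E !mx2E; ring.
Qed.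

Lemma sum_wedge_eq0 (a b : F) : \sum_x \sum_y (x * b - y * a == 0)%:R = 0 :> F.
Proof.
rewrite exchange_big -[RHS](sumr_const_field (b != 0)%:R) /=.
apply: eq_bigr => y _; rewrite -(sum_linear_eq (- (y * a)) b 0).
by apply: eq_bigr => x _; rewrite addrC.
Qed.

(** For independent (a, b) and (c, d) only (x, y) = 0 is counted; otherwise the solutions form a
    line or the whole plane, of size 0 in [F]. *)
Lemma sum_wedge2_eq0 (a b c d : F) :
  \sum_x \sum_y ((x * b - y * a == 0) && (x * d - y * c == 0))%:R
  = (a * d - b * c != 0)%:R :> F.
Proof.
have [dep | indep] /= := eqVneq (a * d - b * c) 0; last first.
  rewrite (bigD1 0) //= (bigD1 0) //= !mul0r !subrr eqxx.
  rewrite !big1 ?addr0 // => [x x0 | y y0].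
    apply: big1 => y _; case: andP => // -[/eqP e1 /eqP e2].
    case/eqP: x0; apply: (mulIf indep); rewrite mul0r.
    by transitivity (a * (x * d - y * c) - c * (x * b - y * a));
      [ring | rewrite e1 e2; ring].
  case: andP => // -[/eqP e1 /eqP e2]; case/eqP: y0; apply: (mulIf indep).
  transitivity (b * (0 * d - y * c) - d * (0 * b - y * a)); first by ring.
  by rewrite !mul0r e1 e2; ring.
(* For proportional vectors with (a', b') nonzero, the first equation implies the second. *)
have half (a' b' c' d' : F) : a' * d' - b' * c' = 0 -> (a' != 0) || (b' != 0) ->
  forall x y, x * b' - y * a' = 0 -> x * d' - y * c' = 0.
  move=> dep' nz x y e; case/orP: nz => nz; apply: (mulfI nz); rewrite mulr0.
    transitivity (x * (a' * d' - b' * c') + c' * (x * b' - y * a')); first by ring.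
    by rewrite dep' e; ring.
  transitivity (y * (a' * d' - b' * c') + d' * (x * b' - y * a')); first by ring.
  by rewrite dep' e; ring.
have [nz | /norP[]] := boolP ((a != 0) || (b != 0)).
  apply: etrans (sum_wedge_eq0 a b); apply: eq_bigr => x _; apply: eq_bigr => y _.
  case: eqP => //= e; rewrite (half a b c d) ?eqxx //.
rewrite !negbK => /eqP-> /eqP->; apply: etrans (sum_wedge_eq0 c d).
by apply: eq_bigr => x _; apply: eq_bigr => y _; rewrite !mulr0 subrr eqxx.
Qed.

(** Inclusion-exclusion: only the term for both equations survives in [F]. *)
Lemma sum_wedge2_neq0 (a b c d : F) :
  \sum_x \sum_y ((x * b - y * a != 0) && (x * d - y * c != 0))%:R
  = (a * d - b * c != 0)%:R :> F.
Proof.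
transitivity (\sum_x \sum_y (1 - (x * b - y * a == 0)%:R
    - (x * d - y * c == 0)%:R
    + ((x * b - y * a == 0) && (x * d - y * c == 0))%:R) : F).
  apply: eq_bigr => x _; apply: eq_bigr => y _.
  by do 2![case: eqP => _] => /=; ring.
under eq_bigr do rewrite !big_split !sumrN /= sumr_const_field.
rewrite !big_split !sumrN /= sumr_const_field !sum_wedge_eq0 sum_wedge2_eq0.
by rewrite !oppr0 !add0r.
Qed.

(** For A not the identity, each nonzero z on its fixed line determines l; for the identity, l = 0
    or z = 0. The cases depend on the off-diagonal entries. *)
Lemma transvection2_fiber A : \det A = 1 -> \tr A = 2 ->
  \sum_x \sum_y \sum_l (transvection2 x y l == A)%:R = -1 :> F.
Proof.
rewrite det2E mxtrace2E => detA trA.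
have trA' : A 1 1 = 2 - A 0 0 by rewrite -trA; ring.
have sqrA : (1 - A 0 0) ^+ 2 = - (A 0 1 * A 1 0).
  transitivity (1 - (A 0 0 * A 1 1 - A 0 1 * A 1 0) - A 0 1 * A 1 0).
    by rewrite trA'; ring.
  by rewrite detA subrr sub0r.
have eqA x y l : transvection2 x y l = A <->
    [/\ l * x * y = 1 - A 0 0, l * x * x = A 0 1 & l * y * y = - A 1 0].
  split=> [<- | [e00 e01 e10]]; first by rewrite !mx2E; split; ring.
  apply: matrix2P; rewrite !mx2E ?e00 ?e01 ?e10 ?trA'; ring.
(* If [A 0 1] is nonzero, x can be any nonzero scalar and determines y and l. *)
have [b0 | b_neq0] := eqVneq (A 0 1) 0; last first.
  transitivity (\sum_(x : F) \sum_(y : F) \sum_(l : F) (x != 0)%:R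
      * ((y == (1 - A 0 0) * x / A 0 1)%:R * (l == A 0 1 / (x * x))%:R) : F).
    apply: eq_bigr => x _; apply: eq_bigr => y _; apply: eq_bigr => l _.
    rewrite -!natrM !mulnb; congr (nat_of_bool _)%:R; apply/eqP/and3P.
      case/eqA => e00 e01 e10.
      have x0 : x != 0 by apply: contraNneq b_neq0 => x0; rewrite -e01 x0 mulr0.
      have l0 : l != 0 by apply: contraNneq b_neq0 => l0; rewrite -e01 l0 !mul0r.
      by split=> //; apply/eqP; rewrite -?e00 -?e01; field; rewrite ?x0 ?l0.
    case=> x0 /eqP-> /eqP->; apply/eqA; split; try by field; rewrite ?x0 ?b_neq0.
    transitivity ((1 - A 0 0) ^+ 2 / A 0 1); first by field; rewrite ?x0 ?b_neq0.
    by rewrite sqrA; field.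
  under eq_bigr => x _.
    under eq_bigr => y _ do rewrite -mulr_sumr -mulr_sumr sum_eq_pred mulr1.
    rewrite -mulr_sumr sum_eq_pred mulr1; over.
  by rewrite sumr_negb_field sum_eq_pred.
have a1 : A 0 0 = 1.
  move/eqP: sqrA; rewrite b0 mul0r oppr0 expf_eq0 /= subr_eq0 eq_sym.
  by move/eqP.
(* If only [A 1 0] is nonzero, the fixed line is x = 0 and each nonzero y determines l. *)
have [c0 | c_neq0] := eqVneq (A 1 0) 0; last first.
  transitivity (\sum_(x : F) \sum_(y : F) \sum_(l : F) (x == 0)%:R
      * ((y != 0)%:R * (l == - A 1 0 / (y * y))%:R) : F).
    apply: eq_bigr => x _; apply: eq_bigr => y _; apply: eq_bigr => l _.
    rewrite -!natrM !mulnb; congr (nat_of_bool _)%:R; apply/eqP/and3P.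
      case/eqA; rewrite b0 => e00 e01 e10.
      have y0 : y != 0.
        by apply: contraNneq c_neq0 => y0; move: e10;
          rewrite y0 mulr0 => /esym/eqP; rewrite oppr_eq0.
      have l0 : l != 0.
        by apply: contraNneq c_neq0 => l0; move: e10;
          rewrite l0 !mul0r => /esym/eqP; rewrite oppr_eq0.
      split=> //; last by rewrite -e10; apply/eqP; field; rewrite y0.
      by move/eqP: e01; rewrite -mulrA !mulf_eq0 (negPf l0) orbb.
    case=> /eqP-> y0 /eqP->; apply/eqA; rewrite a1 b0; split; try by ring.
    by field; rewrite y0.
  under eq_bigr => x _.
    under eq_bigr => y _ do rewrite -mulr_sumr -mulr_sumr sum_eq_pred mulr1.
    rewrite -mulr_sumr sumr_negb_field sum_eq_pred; over.
  by rewrite -mulr_suml sum_eq_pred mul1r.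
(* A is the identity: inclusion-exclusion over l = 0 and (x, y) = 0. *)
transitivity (\sum_(x : F) \sum_(y : F) \sum_(l : F) ((l == 0)%:R + (x == 0)%:R * (y == 0)%:R
   - (x == 0)%:R * ((y == 0)%:R * (l == 0)%:R)) : F).
  apply: eq_bigr => x _; apply: eq_bigr => y _; apply: eq_bigr => l _.
  have -> : (transvection2 x y l == A) = (l == 0) || (x == 0) && (y == 0).
    apply/eqP/orP.
      case/eqA; rewrite a1 b0 c0 subrr oppr0 => _ /eqP e01 /eqP.
      move: e01; rewrite -!mulrA !mulf_eq0 !orbb.
      by case: (l == 0) => /=; [left | move=> -> ->; right].
    case=> [/eqP-> | /andP[/eqP-> /eqP->]]; apply/eqA; rewrite a1 b0 c0;
      split; ring.
  by do 3![case: eqP => _] => /=; ring.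
under eq_bigr => x _.
  under eq_bigr => y _.
    rewrite !big_split /= sum_eq_pred sumr_const_field addr0 sumrN.
    rewrite -!mulr_sumr sum_eq_pred mulr1; over.
  rewrite !big_split /= sumr_const_field add0r sumrN -mulr_sumr.
  rewrite sum_eq_pred mulr1; over.
by rewrite sumrN sum_eq_pred.
Qed.

Hypothesis two_neq0 : 2 != 0 :> F.

(** Nonzero discriminant means m = 0 or 2 fixed points on the projective line, and 1 - m is then 1
    or -1. *)
Lemma eigcount_disc A : (\tr A ^+ 2 - 4 * \det A != 0) -> eigcount A != 0.
Proof.
rewrite mxtrace2E det2E => disc0; rewrite /eigcount exchange_big /=.
have [c0 | c_neq0] := eqVneq (A 1 0) 0.
  have e0 : A 1 1 - A 0 0 != 0.
    apply: contraNneq disc0 => e0; rewrite c0 mulr0 subr0; apply/eqP.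
    by transitivity ((A 1 1 - A 0 0) ^+ 2); [ring | rewrite e0 expr0n].
  under eq_bigr => y _.
    under eq_bigr => x _.
      rewrite (_ : fixform A x y =
        - (A 0 1 * y * y) + x * ((A 1 1 - A 0 0) * y)); last first.
        by rewrite /fixform c0; ring.
      over.
    rewrite sum_linear_eq mulf_eq0 (negPf e0) /=; over.
  by rewrite sumr_negb_field sum_eq_pred oppr_eq0 oner_eq0.
have dc : 2 * A 1 0 != 0 by rewrite mulf_neq0.
set e := A 1 1 - A 0 0.
pose disc := e ^+ 2 + 4 * A 1 0 * A 0 1.
have disc_neq0 : disc != 0.
  by move: disc0; congr (_ != _); rewrite /disc /e; ring.
(* Complete the square: with s = 2 [A 1 0] x + e y, the form times 4 [A 1 0] is s^2 - disc y^2. *)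
have -> : \sum_y \sum_x (fixform A x y == 0)%:R =
    \sum_(y : F) \sum_(s : F) (s * s == disc * y * y)%:R :> F.
  apply: eq_bigr => y _.
  rewrite [RHS](reindex (fun x => 2 * A 1 0 * x + e * y)); last first.
    exists (fun s => (s - e * y) / (2 * A 1 0)) => x _.
      by rewrite addrK mulrC mulKf.
    by rewrite mulrC divfK // subrK.
  apply: eq_bigr => x _; congr (nat_of_bool _)%:R.
  rewrite -[RHS]subr_eq0.
  have -> : (2 * A 1 0 * x + e * y) * (2 * A 1 0 * x + e * y) - disc * y * y
      = 2 * 2 * A 1 0 * fixform A x y by rewrite /disc /fixform /e; ring.
  by rewrite !mulf_eq0 (negPf two_neq0) (negPf c_neq0).
(* If [disc] is not a square, the only solution is y = s = 0. *)
have [r /eqP rr | nsq] := pickP (fun r => r * r == disc); last first.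
  rewrite (bigD1 0) //= [X in _ + X]big1 => [|y y0]; last first.
    apply: big1 => s _; case: eqP => // ss.
    have /eqP[] := nsq (s / y); rewrite mulf_div ss.
    by field; rewrite y0.
  rewrite addr0 (eq_bigr (fun s => (s == 0)%:R)) => [|s _]; last first.
    by rewrite mulr0 mulf_eq0 orbb.
  by rewrite sum_eq_pred oner_eq0.
have r0 : r != 0 by apply: contraNneq disc_neq0 => r0; rewrite -rr r0 mul0r.
(* The roots s = r y and s = - r y coincide only for y = 0. *)
have -> : \sum_(y : F) \sum_(s : F) (s * s == disc * y * y)%:R =
    \sum_(y : F) (2 - (y == 0)%:R) :> F.
  apply: eq_bigr => y _.
  transitivity (\sum_(s : F) ((s == r * y)%:R + (s == - (r * y))%:R
      - (y == 0)%:R * (s == 0)%:R) : F).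
    apply: eq_bigr => s _.
    have -> : (s * s == disc * y * y) = (s == r * y) || (s == - (r * y)).
      by rewrite -eqf_sqr !expr2 -rr; congr (_ == _); ring.
    have [-> | y0] := eqVneq y 0.
      by rewrite mulr0 oppr0; case: eqP => _ /=; ring.
    case: eqP => [-> | _] /=; last by case: eqP => _ /=; ring.
    rewrite (_ : (r * y == - (r * y)) = false) /=; first by ring.
    rewrite -subr_eq0 opprK -mulr2n -mulr_natl !mulf_eq0.
    by rewrite (negPf two_neq0) (negPf r0) (negPf y0).
  by rewrite !big_split /= sumrN -mulr_sumr !sum_eq_pred mulr1.
by rewrite big_split /= sumr_const_field add0r sumrN sum_eq_pred oppr_eq0 oner_eq0.
Qed.

End Counting.

Definition slmx (R : finComUnitRingType) (u : {'SL_2[R]}) : 'M[R]_2 := GLval (val u).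

(** * Sums over parabolic elements of SL(2, F), as sums over transvections *)

Section SpecialLinearMatrix.
Local Open Scope ring_scope.
Variable F : finFieldType.
Local Notation SL := {'SL_2[F]}.
Implicit Types (u v : SL) (A : 'M[F]_2).

Lemma slmx_inj : injective (@slmx F).
Proof. by move=> u v uv; apply/val_inj/val_inj. Qed.

Lemma slmx1 : slmx (1%g : SL) = 1%:M.
Proof. by []. Qed.

Lemma slmxM u v : slmx (u * v)%g = slmx u *m slmx v.
Proof. by []. Qed.

Lemma det_slmx u : \det (slmx u) = 1.
Proof. by have := valP u; rewrite inE => /eqP. Qed.

Lemma slmx_onto A : \det A = 1 -> exists u, slmx u = A.
Proof.
move=> detA; have uA : A \in unitmx by rewrite unitmxE detA unitr1.
have SA : (FinRing.unit _ uA : {'GL_2[F]}) \in SLgroup 2 F by rewrite inE detA.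
by exists (Subg SA).
Qed.

(** By Cayley-Hamilton, (tr u - u) u = det u = 1. *)
Lemma slmxV u : slmx u^-1%g = \tr (slmx u) *: 1%:M - slmx u.
Proof.
have detu := det_slmx u; have uu := sqr_mx2 (slmx u).
have cancel : (\tr (slmx u) *: 1%:M - slmx u) *m slmx u = 1%:M.
  by rewrite mulmxBl -scalemxAl mul1mx uu detu opprB addrC subrK.
transitivity ((\tr (slmx u) *: 1%:M - slmx u) *m (slmx u *m slmx u^-1%g)).
  by rewrite mulmxA cancel mul1mx.
by rewrite -slmxM mulgV slmx1 mulmx1.
Qed.

Lemma sum_slmx (W : nmodType) (P : pred 'M[F]_2) (f : 'M[F]_2 -> W) :
  \sum_(u : SL | P (slmx u)) f (slmx u)
  = \sum_(A | (\det A == 1) && P A) f A.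
Proof.
pose h A := odflt 1%g [pick u | slmx u == A].
have hK u : h (slmx u) = u.
  rewrite /h; case: pickP => [v /eqP/slmx_inj// | /(_ u)].
  by rewrite eqxx.
rewrite [RHS](reindex_onto (@slmx F) h) => [|A /andP[/eqP/slmx_onto[u <-] _]].
  by apply: eq_bigl => u; rewrite det_slmx hK !eqxx andbT.
by rewrite hK.
Qed.

Lemma parabolicN A : parabolic (- A) = parabolic A.
Proof. by rewrite /parabolic raddfN /= eqr_opp eqr_oppLR orbC. Qed.

Lemma parabolicV u : parabolic (slmx u^-1%g) = parabolic (slmx u).
Proof.
rewrite slmxV /parabolic; congr (_ || _); congr (_ == _);
  by rewrite mxtraceD raddfN /= mxtraceZ mxtrace1; ring.
Qed.

(** After exchanging sums, each A is weighted by its number of parametrizations, which is -1 in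
    [F]. *)
Lemma sum_unipotent (f : 'M[F]_2 -> F) :
  \sum_(A | (\det A == 1) && (\tr A == 2)) f A
  = - \sum_x \sum_y \sum_l f (transvection2 x y l).
Proof.
transitivity (- \sum_x \sum_y \sum_l \sum_(A | (\det A == 1) && (\tr A == 2))
    f A * (transvection2 x y l == A)%:R); last first.
  congr (- _); apply: eq_bigr => x _; apply: eq_bigr => y _.
  apply: eq_bigr => l _; rewrite (bigD1 (transvection2 x y l)) /=; last first.
    by rewrite transvection2_det transvection2_tr !eqxx.
  rewrite eqxx mulr1 big1 ?addr0 // => A /andP[_ /negPf].
  by rewrite eq_sym => ->; rewrite mulr0.
under [in RHS]eq_bigr => x _.
  under eq_bigr => y _ do rewrite exchange_big.
  rewrite exchange_big; over.
rewrite exchange_big -sumrN /=; apply: eq_bigr => A /andP[/eqP detA /eqP trA].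
under eq_bigr => x _.
  under eq_bigr => y _ do rewrite -mulr_sumr.
  rewrite -mulr_sumr; over.
by rewrite -mulr_sumr transvection2_fiber // mulrN1 opprK.
Qed.

Hypothesis two_neq0 : 2 != 0 :> F.

Lemma two_neqN2 : (2 == - 2 :> F) = false.
Proof.
apply/negbTE; rewrite -subr_eq0 opprK (_ : 2 + 2 = 2 * 2 :> F); last by ring.
by rewrite mulf_neq0.
Qed.

(* In characteristic p, summing over parabolic elements is the same as summing
   over the parametrized transvections (up to sign), because each nontrivial
   one has q - 1 parametrizations and the identity has q^2 + q - 1. *)
Lemma sum_parabolic (f : 'M[F]_2 -> F) :
  \sum_(u : SL | parabolic (slmx u)) f (slmx u)
  = - \sum_x \sum_y \sum_l (f (transvection2 x y l) + f (- transvection2 x y l)).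
Proof.
rewrite sum_slmx (bigID (fun A => \tr A == 2)) /=.
(* Negation exchanges trace 2 and trace -2, which differ because 4 is nonzero. *)
transitivity (\sum_(A | (\det A == 1) && (\tr A == 2)) f A
    + \sum_(A | (\det A == 1) && (\tr A == 2)) f (- A)).
  congr (_ + _); last rewrite [RHS](reindex_inj oppr_inj) /=.
    apply: eq_bigl => A; rewrite /parabolic.
    by case: (\tr A =P 2) => /=; rewrite ?andbT ?andbF.
  apply: eq_big => [A | A _]; last by rewrite opprK.
  have -> : \det (- A) = \det A by rewrite !det2E !mxE; ring.
  rewrite raddfN /= eqr_oppLR /parabolic.
  by case: (\tr A =P 2) => [-> | _]; rewrite ?andbF ?two_neqN2 ?andbF ?andbT.
rewrite !sum_unipotent -opprD -big_split; congr (- _); apply: eq_bigr => x _.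
rewrite -big_split; apply: eq_bigr => y _; by rewrite -big_split.
Qed.

(** If [fixform A x y] is nonzero, tr A + l [fixform A x y] takes each of the values 2 and -2 once
    as l varies, and the two signs of the transvection make this 4; otherwise the sum over l is 0 in
    [F]. This gives N^2 = 4 D. *)
Lemma parabolic_walk2 A :
  \sum_(u : SL | parabolic (slmx u)) (parabolic (slmx u *m A))%:R
  = 4 * eigcount A :> F.
Proof.
rewrite (sum_parabolic (fun B => (parabolic (B *m A))%:R)).
transitivity (- \sum_x \sum_y (4 * (fixform A x y != 0)%:R) : F).
  congr (- _); apply: eq_bigr => x _; apply: eq_bigr => y _.
  transitivity (\sum_l (2 * (\tr A + l * fixform A x y == 2)%:R
      + 2 * (\tr A + l * fixform A x y == - 2)%:R) : F).
    apply: eq_bigr => l _; rewrite mulNmx parabolicN /parabolic.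
    rewrite transvection2_mul_tr.
    case: eqP => [-> | _] /=; last by case: eqP => _ /=; ring.
    by rewrite two_neqN2 /=; ring.
  rewrite big_split /= -!mulr_sumr !sum_linear_eq.
  by move: (nat_of_bool _)%:R => c; ring.
under eq_bigr do rewrite -mulr_sumr.
by rewrite -mulr_sumr sumr_negb_field2 mulrN opprK.
Qed.

Lemma eigcountN A : eigcount (- A) = eigcount A.
Proof.
apply: eq_bigr => x _; apply: eq_bigr => y _; congr (nat_of_bool _)%:R.
rewrite -[RHS]oppr_eq0; congr (_ == _); rewrite /fixform !mxE; ring.
Qed.

(** For fixed w = (a, b) the form of the product at w is affine in l, with slope - det(z, w) det(z,
    A w). The sum over l tests that the slope is nonzero, and the sum over z then tests that w and A
    w are independent. This gives N D = 2 D. *)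
Lemma parabolic_walk_eigcount A :
  \sum_(u : SL | parabolic (slmx u)) eigcount (slmx u *m A) = 2 * eigcount A.
Proof.
rewrite (sum_parabolic (fun B => eigcount (B *m A))).
pose h l x y a b := fixform (transvection2 x y l *m A) a b == 0.
transitivity (- \sum_a \sum_b (2 * \sum_x \sum_y \sum_l (h l x y a b)%:R) : F).
  congr (- _).
  transitivity (\sum_x \sum_y \sum_l \sum_a \sum_b (2 * (h l x y a b)%:R) : F).
    apply: eq_bigr => x _; apply: eq_bigr => y _; apply: eq_bigr => l _.
    rewrite mulNmx eigcountN -mulr2n -[LHS]mulr_natl /eigcount mulr_sumr.
    by apply: eq_bigr => a _; rewrite mulr_sumr.
  under eq_bigr => x _.
    under eq_bigr => y _.
      rewrite exchange_big /=.
      under eq_bigr => a _ do rewrite exchange_big /=.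
      over.
    rewrite exchange_big /=.
    under eq_bigr => a _ do rewrite exchange_big /=.
    over.
  rewrite exchange_big /=; apply: eq_bigr => a _.
  rewrite exchange_big /=; apply: eq_bigr => b _.
  rewrite mulr_sumr; apply: eq_bigr => x _.
  rewrite mulr_sumr; apply: eq_bigr => y _.
  by rewrite mulr_sumr.
transitivity (- \sum_a \sum_b (2 * (fixform A a b != 0)%:R) : F); last first.
  under eq_bigr do rewrite -mulr_sumr.
  by rewrite -mulr_sumr sumr_negb_field2 mulrN opprK.
congr (- _); apply: eq_bigr => a _; apply: eq_bigr => b _; congr (_ * _).
pose c := A 0 0 * a + A 0 1 * b; pose d := A 1 0 * a + A 1 1 * b.
have -> : (fixform A a b != 0) = (a * d - b * c != 0).
  by congr (_ != _); rewrite /fixform /c /d; ring.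
rewrite -sum_wedge2_neq0; apply: eq_bigr => x _; apply: eq_bigr => y _.
rewrite -negb_or -mulf_eq0 -oppr_eq0 -(sum_linear_eq (fixform A a b) _ 0).
apply: eq_bigr => l _; congr (nat_of_bool _)%:R; congr (_ == _).
by rewrite fixform_transvection2_mul mulrN.
Qed.

End SpecialLinearMatrix.

(** * Characteristic p: Frobenius for commuting sums, and element orders in SL(2, F) *)

Lemma sumrX_pchar (R : nzSemiRingType) (p n : nat) (I : Type) (r : seq I)
    (P : pred I) (x : I -> R) :
  (p \in [pchar R])%R -> (forall i j, GRing.comm (x i) (x j)) ->
  ((\sum_(i <- r | P i) x i) ^+ (p ^ n) = \sum_(i <- r | P i) x i ^+ (p ^ n))%R.
Proof.
move=> pcharRp comm_x; have p_gt0 := prime_gt0 (pcharf_prime pcharRp).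
elim: n => [|n IH].
  by rewrite expr1; apply: eq_bigr.
rewrite expnSr exprM IH; under [RHS]eq_bigr do rewrite exprM.
elim: r {IH} => [|i r IH]; first by rewrite !big_nil expr0n gtn_eqF.
rewrite !big_cons; case: ifP => // _.
rewrite -(pFrobenius_autE pcharRp) pFrobenius_autD_comm ?pFrobenius_autE ?IH //.
apply: commr_sum => j _; apply: commrX; apply/commr_sym/commrX; exact: comm_x.
Qed.

Section PrimeCharacteristic.
Local Open Scope ring_scope.
Variables (p : nat) (F : finFieldType).
Hypotheses (pcharFp : p \in [pchar F]) (two_neq0 : 2 != 0 :> F).
Local Notation SL := {'SL_2[F]}.
Implicit Types u v : SL.

Let p_prime : prime p := pcharf_prime pcharFp.

Lemma slmxX u n : slmx (u ^+ n)%g = slmx u ^+ n.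
Proof. by elim: n => // n IH; rewrite expgS slmxM IH exprS. Qed.

(** By Frobenius, u^p = 1 means B^p = 0 for B = u - 1. As tr B = tr u - 2 = - det B, Cayley-Hamilton
    makes B nilpotent exactly for trace 2. *)
Lemma unipotentE u : (u ^+ p == 1)%g = (\tr (slmx u) == 2).
Proof.
have pcharM : p \in [pchar 'M[F]_2] by rewrite pchar_lalg.
pose B := slmx u - 1%:M : 'M[F]_2.
have trB : \tr B = \tr (slmx u) - 2 by rewrite raddfB /= mxtrace1.
have detB : \det B = 2 - \tr (slmx u).
  have := det_slmx u; rewrite mxtrace2E !det2E !mxE /= => detu.
  by rewrite -[X in _ = _ + X - _]detu; ring.
have -> : (u ^+ p == 1)%g = (B ^+ p == 0).
  rewrite -(inj_eq (@slmx_inj F)) slmxX -(pFrobenius_autE pcharM B).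
  rewrite pFrobenius_autB_comm; last exact: commr1.
  by rewrite pFrobenius_aut1 pFrobenius_autE subr_eq0.
apply/eqP/eqP => [Bp | tr2].
  have detX n : \det (B ^+ n) = \det B ^+ n.
    by elim: n => [|n IH]; rewrite ?det1 // !exprS det_mulmx IH.
  have /eqP : \det B ^+ p = 0 by rewrite -detX Bp det0.
  by rewrite detB expf_eq0 prime_gt0 //= subr_eq0 => /eqP.
have BB : B ^+ 2 = 0.
  by rewrite expr2 -[LHS]/(B *m B) sqr_mx2 trB detB tr2 subrr scale0r raddf0 subrr.
by rewrite -(subnK (prime_gt1 p_prime)) exprD BB mulr0.
Qed.

Lemma slmx_opp1 : slmx (SL2_opp1 F) = - 1%:M.
Proof. exact: SL2_opp1E. Qed.

Lemma SL2_opp1_neq1 : SL2_opp1 F != 1%g.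
Proof.
apply: contra_neq two_neq0 => /(congr1 (@slmx F)) /matrixP/(_ 0 0).
rewrite slmx_opp1 slmx1 !mxE /= => e.
by rewrite -[2]/(1 + 1) -{1}(e : -1 = 1) addNr.
Qed.

Lemma SL2_opp1_sqr : (SL2_opp1 F * SL2_opp1 F = 1)%g.
Proof. by apply: slmx_inj; rewrite slmxM slmx_opp1 mulmxN mulNmx opprK mulmx1. Qed.

(** From u = u^-1 = tr u - u, u is scalar, and determinant 1 leaves 1 and -1. *)
Lemma SL2_involution u : (u * u = 1)%g -> u != 1%g -> u = SL2_opp1 F.
Proof.
move=> uu; rewrite -(inj_eq (@slmx_inj F)) => u1.
have uV : slmx u = slmx u^-1%g
  by congr slmx; rewrite -[LHS]mulg1 -(mulgV u) mulgA uu mul1g.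
have scal : slmx u = (\tr (slmx u) / 2)%:M.
  apply: (scalerI two_neq0); rewrite scale_scalar_mx mulrC divfK //.
  rewrite scaler_nat mulr2n {2}uV slmxV addrC subrK.
  by rewrite scale_scalar_mx mulr1.
have := det_slmx u; rewrite scal det_scalar => /eqP; rewrite sqrf_eq1.
case/orP=> /eqP e; first by rewrite scal e slmx1 eqxx in u1.
by apply: slmx_inj; rewrite scal e slmx_opp1 raddfN.
Qed.

(** Trace 2 amounts to u^p = 1 and trace -2 to u^p = t; primality of p turns these into orders. *)
Lemma parabolicE u :
  parabolic (slmx u) =
  (u \in (1%g : {set SL}) :|: (SL2_opp1 F |: SL2_order_p_2p F p)).
Proof.
have p_gt0 := prime_gt0 p_prime; have p_gt1 := prime_gt1 p_prime.
set t := SL2_opp1 F; have t_neq1 := SL2_opp1_neq1; have tt := SL2_opp1_sqr.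
have podd : odd p.
  have [p2 | //] := even_prime p_prime.
  by have /eqP := pcharf0 pcharFp; rewrite p2 (negPf two_neq0).
have tX n : (t ^+ n = if odd n then t else 1)%g.
  by elim: n => // n IH; rewrite expgS IH /=; case: (odd n); rewrite ?mulg1.
have unip2 : (\tr (slmx u) == - 2) = (u ^+ p == t)%g.
  have tu : commute t u.
    by apply: slmx_inj; rewrite !slmxM slmx_opp1 mulNmx mulmxN mul1mx mulmx1.
  (* For odd p, (t u)^p = t u^p, and t u has the opposite trace. *)
  have := unipotentE (t * u)%g; rewrite expgMn // tX podd.
  rewrite slmxM slmx_opp1 mulNmx mul1mx raddfN /= eqr_oppLR => <-.
  by rewrite -(inj_eq (mulgI t)) mulgA tt mul1g mulg1.
have order_p : (u ^+ p == 1)%g = (u == 1)%g || (#[u]%g == p).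
  rewrite -order_dvdn -order_eq1; apply/idP/orP => [|[] /eqP->] //.
  by move=> /(primeP p_prime).2 /orP.
have order_2p : (u ^+ p == t)%g = (u == t)%g || (#[u]%g == 2 * p)%N.
  apply/eqP/orP => [up | [/eqP-> | /eqP ou]]; last first.
  (* u^p has order 2, so it is t, the only involution. *)
  - have ou2 : #[u ^+ p]%g = 2%N by rewrite orderXdiv ou ?dvdn_mull // mulnK.
    apply: SL2_involution; last by rewrite -order_eq1 ou2.
    by have := expg_order (u ^+ p)%g; rewrite ou2 expg2.
  - by rewrite tX podd.
  have u_dvd : (#[u]%g %| 2 * p)%N by rewrite order_dvdn mulnC expgM up expg2 tt.
  (* If p divides the order, it is p or 2 p, and p would give t = 1. Otherwise u^2 = 1, so t = u^p =
     u. *)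
  have [/dvdnP[r ur] | p'u] := boolP (p %| #[u]%g)%N.
    move: u_dvd; rewrite ur dvdn_pmul2r // => /(primeP (erefl : prime 2%N)).2.
    case/orP=> /eqP r_def; last by right; rewrite r_def.
    by case/eqP: t_neq1; rewrite r_def mul1n in ur; rewrite -[LHS]/t -up -{1}ur expg_order.
  move: u_dvd; rewrite Gauss_dvdl; last by rewrite coprime_sym prime_coprime.
  rewrite order_dvdn => /eqP u2; left; move: up.
  by rewrite -(odd_double_half p) podd add1n expgS -mul2n expgM u2 expg1n mulg1 => ->.
rewrite /parabolic -unipotentE unip2 order_p order_2p !inE -!orbA.
by congr (_ || _); rewrite orbCA.
Qed.

End PrimeCharacteristic.

(** * Sizes of SL(2, F), of its parabolic set, and of the set of q-th powers *)

Section Cardinals.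
Local Open Scope nat_scope.
Variable F : finFieldType.
Local Notation SL := {'SL_2[F]}.
Let q := #|F|.

Lemma card_mx2 (P : pred 'M[F]_2) :
  #|P| = \sum_(a : F) \sum_(b : F) \sum_(c : F) \sum_(d : F) P (mx2 a b c d).
Proof.
pose f (t : F * F * F * F) := mx2 t.1.1.1 t.1.1.2 t.1.2 t.2.
pose g (A : 'M[F]_2) : F * F * F * F := (A 0%R 0%R, A 0%R 1%R, A 1%R 0%R, A 1%R 1%R).
have fK : cancel f g by move=> [[[a b] c] d]; rewrite /g /f !mx2E.
have gK : cancel g f by exact: mx2_eta.
rewrite -sum1_card (reindex f) /=; last by exists g => t _.
rewrite big_mkcond /=.
transitivity (\sum_(t : F * F * F * F) nat_of_bool (P (f t))).
  by apply: eq_bigr => t _; rewrite unfold_in; case: (P _).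
rewrite -(pair_bigA _ (fun s d => nat_of_bool (P (f (s, d))))) /=.
rewrite -(pair_bigA _ (fun s c => \sum_d nat_of_bool (P (f (s, c, d))))) /=.
by rewrite -(pair_bigA _ (fun a b => \sum_c \sum_d nat_of_bool (P (f (a, b, c, d))))).
Qed.

Lemma sum_eq_linear (a b s : F) :
  \sum_(l : F) (a + l * b == s)%R = if b == 0%R then q * (a == s) else 1.
Proof.
have [-> | b0] := eqVneq b 0%R.
  by under eq_bigr do rewrite mulr0 addr0; rewrite sum_nat_const.
rewrite (bigD1 ((s - a) / b)%R) //= divfK // addrC subrK eqxx big1 // => l.
apply: contraNeq; rewrite eqb0 negbK => /eqP <-.
by rewrite addrC addrA addNr add0r mulfK.
Qed.

Lemma sum_if_eq (a : F) (m n : nat) :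
  \sum_(x : F) (if x == a then m else n) = m + (q - 1) * n.
Proof.
rewrite (bigD1 a) //= eqxx; congr (_ + _).
rewrite (eq_bigr (fun=> n)) => [|x /negPf-> //].
rewrite sum_nat_const; congr (_ * _).
by rewrite (cardC1 a) subn1.
Qed.

(** Nonzero a determines d from b and c; a = 0 leaves q - 1 pairs (b, c) and a free d. *)
Lemma card_SL2 : #|{: SL}| = q * (q ^ 2 - 1).
Proof.
have q_gt0 : 0 < q by apply/card_gt0P; exists 0%R.
have -> : #|{: SL}| = #|[pred A : 'M[F]_2 | (\det A == 1)%R]|.
  rewrite -(card_image (@slmx_inj F)); apply: eq_card => A; rewrite !inE.
  apply/imageP/eqP => [[u _ ->] | /slmx_onto[u <-]]; first exact: det_slmx.
  by exists u.
rewrite card_mx2 /=.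
have row (a b c : F) : \sum_(d : F) (\det (mx2 a b c d) == 1)%R =
    if a == 0%R then q * (- (b * c) == 1)%R else 1.
  apply: etrans (sum_eq_linear (- (b * c))%R a 1%R).
  apply: eq_bigr => d _; by rewrite det2E !mx2E addrC (mulrC a).
transitivity (\sum_(a : F) if a == 0%R then q * (q - 1) else q * q).
  apply: eq_bigr => a _; have [a0 | a0] := boolP (a == 0%R); last first.
    under eq_bigr => b _.
      under eq_bigr do rewrite row (negPf a0).
      rewrite sum_nat_const muln1; over.
    by rewrite sum_nat_const.
  under eq_bigr => b _.
    under eq_bigr => c _.
      rewrite row a0 (_ : (- (b * c)) = 0 + c * (- b))%R; last by ring.
      over.
    rewrite -big_distrr sum_eq_linear /= oppr_eq0 [(0 == 1)%R]eq_sym oner_eq0 muln0; over.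
  rewrite -big_distrr sum_if_eq /= add0n muln1 //.
rewrite sum_if_eq.
by rewrite -{2}(subnK q_gt0); nia.
Qed.

Lemma card_parabolic : #|[set u : SL | parabolic (slmx u)]| <= 2 * q ^ 2.
Proof.
have q_gt0 : 0 < q by apply/card_gt0P; exists 0%R.
have bound (e : F) : (e * e = 1)%R ->
    #|[pred A : 'M[F]_2 | (\det A == 1)%R && (\tr A == 2 * e)%R]| = q ^ 2.
  move=> ee; rewrite card_mx2 /=.
  (* The trace forces d = 2 e - a, and determinant 1 = e^2 becomes (a - e)^2 + c b = 0. *)
  have row (a b c : F) : \sum_(d : F) ((\det (mx2 a b c d) == 1) && (\tr (mx2 a b c d) == 2 * e))%R
      = ((a - e) * (a - e) + c * b == 0)%R.
    rewrite (bigD1 (2 * e - a)%R) //= big1 ?addn0 => [|d]; last first.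
      apply: contraNeq; rewrite eqb0 negbK mxtrace2E !mx2E => /andP[_ /eqP <-].
      by rewrite addrC addKr.
    rewrite mxtrace2E det2E !mx2E subrKC eqxx andbT.
    rewrite -subr_eq0 -[in RHS]oppr_eq0; congr (nat_of_bool (_ == 0%R)).
    by ring: ee.
  have nil (a : F) : ((a - e) * (a - e) == 0)%R = (a == e).
    by rewrite mulf_eq0 orbb subr_eq0.
  under eq_bigr => a _.
    under eq_bigr => b _.
      under eq_bigr do rewrite row.
      rewrite sum_eq_linear nil; over.
    rewrite sum_if_eq muln1; over.
  rewrite big_split /= sum_nat_const -big_distrr /=.
  rewrite (eq_bigr (fun a => if a == e then 1 else 0)) => [|a _]; last by case: eqP.
  rewrite sum_if_eq -/q muln0 addn0 -mulnDr subnKC //.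
have -> : #|[set u : SL | parabolic (slmx u)]|
    = #|[pred A : 'M[F]_2 | (\det A == 1)%R && parabolic A]|.
  rewrite -(card_imset _ (@slmx_inj F)); apply: eq_card => A; rewrite !inE.
  apply/imsetP/andP => [[u] | [/eqP/slmx_onto[u <-] parA]].
    by rewrite inE => paru ->; rewrite det_slmx.
  by exists u; rewrite ?inE.
rewrite mul2n -addnn -{1}(bound 1%R (mulr1 _)) -(bound (-1)%R); last by rewrite mulrNN mulr1.
rewrite -cardUI; apply: leq_trans (leq_addr _ _).
apply: subset_leq_card; apply/subsetP=> A; rewrite !inE mulr1 mulrN1.
by rewrite -andb_orr.
Qed.

End Cardinals.

(** By Lagrange, q-th powers have order dividing m, so they lie in the p'-core, a Hall subgroup of
    order m. *)
Lemma card_expg_abelian (gT : finGroupType) (G : {group gT}) (p q m : nat) :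
  abelian G -> #|G| = (q * m)%N -> p.-nat q -> p^'.-nat m ->
  #|[set x ^+ q | x in G]| <= m.
Proof.
move=> abG oG pq p'm.
have hallG := nilpotent_pcore_Hall p^' (abelian_nil abG).
have <- : #|'O_p^'(G)| = m.
  have [q0 m0] : 0 < q /\ 0 < m by case/andP: pq => ->; case/andP: p'm => ->.
  rewrite (card_Hall hallG) oG partnM // (part_pnat_id p'm) part_p'nat ?mul1n //.
  by rewrite pnatNK.
apply/subset_leq_card/subsetP=> _ /imsetP[x Gx ->].
rewrite (mem_Hall_pcore hallG) ?groupX // /p_elt.
apply: pnat_dvd p'm; rewrite order_dvdn -expgM -oG; exact/eqP/expg_cardG.
Qed.

(** * Permutation matrices and Frobenius *)

Section PermutationMatrices.
Local Open Scope ring_scope.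
Variables (R : nzRingType) (V : finType) (n : nat) (en : 'I_n.+1 -> V).
Hypothesis en_bij : bijective en.

(** Size [n.+1] makes the matrices a nonzero ring; indexing rows by sources makes products match
    left-to-right composition. *)
Definition perm_matrix (s : {perm V}) : 'M[R]_n.+1 :=
  \matrix_(i, j) (s (en i) == en j)%:R.

Lemma perm_matrix1 : perm_matrix 1 = 1.
Proof. by apply/matrixP=> i j; rewrite !mxE perm1 (bij_eq en_bij). Qed.

Lemma perm_matrixM (s t : {perm V}) :
  perm_matrix (s * t)%g = perm_matrix s * perm_matrix t.
Proof.
case: (en_bij) => em enK emK; apply/matrixP=> i j; rewrite !mxE.
rewrite (bigD1 (em (s (en i)))) //= !mxE emK eqxx mul1r permM.
rewrite big1 ?addr0 // => l; rewrite !mxE.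
by rewrite -(can2_eq enK emK) eq_sym => /negPf->; rewrite mul0r.
Qed.

Lemma perm_matrixX (s : {perm V}) m : perm_matrix (s ^+ m)%g = perm_matrix s ^+ m.
Proof.
by elim: m => [|m IH]; rewrite ?perm_matrix1 // expgS perm_matrixM IH exprS.
Qed.

(** Frobenius turns the power into the sum of the matrices of [s u ^+ (p ^ k)], and a nonzero entry
    needs a nonzero summand. *)
Lemma perm_matrix_walk (p k : nat) (I : finType) (P : pred I)
    (s : I -> {perm V}) (i j : 'I_n.+1) :
  p \in [pchar 'M[R]_n.+1] -> (forall u v, commute (s u) (s v)) ->
  ((\sum_(u | P u) perm_matrix (s u)) ^+ (p ^ k)) i j != 0 ->
  exists u, (s u ^+ (p ^ k))%g (en i) = en j.
Proof.
move=> pcharM comm_s.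
rewrite sumrX_pchar // => [|u v]; last first.
  by rewrite /GRing.comm -!perm_matrixM comm_s.
have [u /eqP <- _ | none] := pickP (fun u => (s u ^+ (p ^ k))%g (en i) == en j).
  by exists u.
rewrite summxE big1 ?eqxx // => u _.
by rewrite -perm_matrixX mxE none.
Qed.

End PermutationMatrices.

(** * Powers of the closed adjacency matrix *)

Section ClosedAdjacency.
Local Open Scope ring_scope.
Variables (F : finFieldType) (n : nat) (en : 'I_n.+1 -> {'SL_2[F]}).
Hypotheses (two_neq0 : 2 != 0 :> F) (en_bij : bijective en).

Definition closed_adjacency : 'M[F]_n.+1 :=
  \matrix_(i, j) (parabolic (slmx (en j * (en i)^-1)%g))%:R.

Definition eigcount_matrix : 'M[F]_n.+1 :=
  \matrix_(i, j) eigcount (slmx (en i * (en j)^-1)%g).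

Lemma closed_adjacency_mul (M : 'M[F]_n.+1) (f : {'SL_2[F]} -> F) i j :
  (forall l, M l j = f (en l)) ->
  (closed_adjacency * M) i j
  = \sum_(u | parabolic (slmx u)) f (u * en i)%g.
Proof.
move=> Mf; rewrite mxE [RHS]big_mkcond /= [RHS](reindex_inj (mulIg (en i)^-1)%g) /=.
rewrite (reindex en) /=; last exact: onW_bij.
apply: eq_bigr => l _; rewrite mulgKV mxE Mf.
by case: ifP => _; rewrite ?mul1r ?mul0r.
Qed.

Lemma closed_adjacency_sqr :
  closed_adjacency * closed_adjacency = 4 *: eigcount_matrix.
Proof.
apply/matrixP=> i j.
rewrite (closed_adjacency_mul
  (f := fun w => (parabolic (slmx (w * (en j)^-1)%g))%:R)) => [|l]; last first.
  by rewrite mxE -parabolicV invMg invgK.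
rewrite !mxE -parabolic_walk2 //; apply: eq_bigr => u _.
by rewrite -slmxM mulgA.
Qed.

Lemma closed_adjacency_eigcount :
  closed_adjacency * eigcount_matrix = 2 *: eigcount_matrix.
Proof.
apply/matrixP=> i j.
rewrite (closed_adjacency_mul
  (f := fun w => eigcount (slmx (w * (en j)^-1)%g))) => [|l]; last by rewrite mxE.
rewrite !mxE -parabolic_walk_eigcount //; apply: eq_bigr => u _.
by rewrite -slmxM mulgA.
Qed.

Lemma closed_adjacencyX m :
  closed_adjacency ^+ m.+2 = (2 ^+ m * 4) *: eigcount_matrix.
Proof.
elim: m => [|m IH]; first by rewrite expr0 mul1r expr2 closed_adjacency_sqr.
rewrite exprS IH -scalerAr closed_adjacency_eigcount scalerA.
by congr (_ *: _); rewrite exprS; ring.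
Qed.

(** For determinant 1, nonparabolic means tr^2 differs from 4, which is the nonzero discriminant of
    [eigcount_disc]. *)
Lemma closed_adjacencyX_neq0 m i j : (1 < m)%N ->
  ~~ parabolic (slmx (en i * (en j)^-1)%g) -> (closed_adjacency ^+ m) i j != 0.
Proof.
case: m => [|[|m]] // _ nonpar; rewrite closed_adjacencyX !mxE.
have four : 4 != 0 :> F.
  by rewrite (_ : 4 = 2 * 2) ?mulf_neq0 //; ring.
rewrite !mulf_neq0 ?expf_neq0 // eigcount_disc // det_slmx mulr1.
rewrite (_ : 4 = 2 ^+ 2); last by ring.
rewrite subr_eq0 eqf_sqr; exact: nonpar.
Qed.

End ClosedAdjacency.

(** * The regular action of an abelian group, transported to the vertices *)

Section RegularAbelianAction.
Variables (V : finType) (K : groupType) (phi : V -> K) (psi : K -> V).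
Hypotheses (phiK : cancel phi psi) (psiK : cancel psi phi).
Hypothesis K_abelian : forall x y : K, commute x y.

Lemma translation_inj (k : K) : injective (fun x => psi (k * phi x)).
Proof. by move=> x y /(can_inj psiK) /mulgI /(can_inj phiK). Qed.

Definition translation (k : K) : {perm V} := perm (@translation_inj k).

Lemma translationE k x : translation k x = psi (k * phi x).
Proof. exact: permE. Qed.

(** Left translations compose in the opposite order, which commutativity of [K] absorbs. *)
Lemma translationM j k : translation (j * k) = translation j * translation k.
Proof.
by apply/permP=> x; rewrite permM !translationE psiK mulgA (K_abelian j).
Qed.

(** A copy of [K] as a finite permutation group, to which finite group theory applies. *)
Definition translations : {set {perm V}} := [set translation (phi u) | u : V].

Lemma mem_translations k : translation k \in translations.
Proof. by apply/imsetP; exists (psi k); rewrite ?psiK. Qed.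

Lemma translations_group_set : group_set translations.
Proof.
apply/group_setP; split=> [|_ _ /imsetP[u _ ->] /imsetP[v _ ->]].
  have -> : 1 = translation 1; last exact: mem_translations.
  by apply/permP=> x; rewrite perm1 translationE mul1g phiK.
by rewrite -translationM mem_translations.
Qed.
Canonical translations_group := Group translations_group_set.

Lemma translations_abelian : abelian translations.
Proof.
apply/centsP=> _ /imsetP[u _ ->] _ /imsetP[v _ ->].
by rewrite /commute -!translationM (K_abelian (phi u)).
Qed.

Lemma card_translations (x : V) : #|translations| = #|V|.
Proof.
apply: card_imset => u v /permP/(_ x).
by rewrite !translationE => /(can_inj psiK) /mulIg /(can_inj phiK).
Qed.

End RegularAbelianAction.

(** * Nonneighbours of 1 as images under q-th powers, and the final count *)

Theorem theorem6p10 (p k q : nat) (F : finFieldType)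
    (p_prime : prime p) (k_gt0 : 0 < k) (q_def : q = (p ^ k)%N)
    (q_odd : odd q) (q_ge5 : 5 <= q) (F_card : #|F| = q)
    (K : groupType) (K_abelian : forall x y : K, commute x y) :
  ~ Cayley_graph_of K (Cay (SL2_opp1 F |: SL2_order_p_2p F p)).
Proof.
case=> C [_ _] [phi [psi phiK psiK] phi_iso].
have pcharFp : p \in [pchar F]%R by apply: (card_finPcharP (n := k)); rewrite ?F_card.
have two_neq0 : (2 != 0 :> F)%R.
  apply/eqP=> two0; have /eqP := natr_card_field F.
  rewrite F_card -(odd_double_half q) q_odd -mul2n natrD natrM two0.
  by rewrite mul0r addr0 oner_eq0.
have adjE x y : parabolic (slmx (y * x^-1))
    = (y == x) || (phi y * (phi x)^-1 \in C).
  rewrite (parabolicE pcharFp) // in_setU; congr (_ || _).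
    by rewrite inE -(inj_eq (mulIg x)) mulgKV mul1g.
  exact/esym/phi_iso.
have [n V_card] : exists n, #|{'SL_2[F]}| = n.+1.
  by exists #|{'SL_2[F]}|.-1; rewrite prednK //; apply/card_gt0P; exists 1.
pose en (i : 'I_n.+1) := enum_val (cast_ord (esym V_card) i).
have en_bij : bijective en.
  exists (fun u => cast_ord V_card (enum_rank u)) => x.
    by rewrite /en enum_valK cast_ordKV.
  by rewrite /en cast_ordK enum_rankK.
(* [s u] is the translation taking 1 to u; [phi 1] need not be the identity of [K]. *)
pose s u := translation phiK psiK (phi u * (phi 1)^-1).
have adj_sum : closed_adjacency en
    = (\sum_(u | parabolic (slmx u)) perm_matrix F en (s u))%R.
  apply/matrixP=> i j; rewrite mxE summxE.
  set x := en i; set y := en j.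
  (* The only index whose translation takes x to y. *)
  pose u0 := psi (phi y * (phi x)^-1 * phi 1).
  have su u : (s u x == y) = (u == u0).
    rewrite translationE; apply/eqP/eqP=> [yE | ->]; last first.
      by rewrite psiK mulgK mulgKV phiK.
    by rewrite /u0 -yE psiK mulgK mulgKV phiK.
  (* Both sides say that [phi y * (phi x)^-1] is 1 or lies in [C]. *)
  have -> : parabolic (slmx (y * x^-1)) = parabolic (slmx u0).
    rewrite -[u0]mulg1 -[X in u0 * X]invg1 !adjE psiK mulgK; congr (_ || _).
    rewrite -(inj_eq (can_inj phiK)) -[RHS](inj_eq (can_inj phiK)) psiK.
    apply/eqP/eqP=> [-> | e]; first by rewrite mulgV mul1g.
    by apply: (mulIg (phi x)^-1); apply: (mulIg (phi 1)); rewrite e mulgV mul1g.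
  rewrite big_mkcond (bigD1 u0) //= mxE su eqxx big1 ?addr0 => [|u /negPf u_neq].
    by case: ifP.
  by rewrite mxE su u_neq; case: ifP.
have q_gt1 : 1 < q := leq_trans (isT : 1 < 5) q_ge5.
have q_power u : ~~ parabolic (slmx u) -> exists v, (s v ^+ q) 1 = u.
  have [em _ emK] := en_bij => nonpar.
  have pcharM : p \in [pchar 'M[F]_n.+1]%R by rewrite pchar_lalg.
  have comm_s v w : commute (s v) (s w).
    by rewrite /commute -!(translationM phiK psiK K_abelian) K_abelian.
  have : ((closed_adjacency en ^+ q) (em 1%g) (em u) != 0)%R.
    by rewrite closed_adjacencyX_neq0 // !emK mul1g parabolicV.
  rewrite adj_sum q_def => /(perm_matrix_walk en_bij pcharM comm_s)[v].
  by rewrite !emK => <-; exists v.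
have pq : p.-nat q by rewrite q_def pnatX pnat_id ?orbT.
(* p divides q^2, hence not q^2 - 1. *)
have p'm : p^'.-nat (q ^ 2 - 1)%N.
  rewrite p'natE // dvdn_subr ?dvdn1 ?expn_gt0 ?(ltnW q_gt1) //.
    by rewrite neq_ltn prime_gt1 ?orbT.
  by rewrite q_def -expnM dvdn_exp ?muln_gt0 ?k_gt0.
pose T := translations_group phiK psiK K_abelian.
have T_card : #|T| = (q * (q ^ 2 - 1))%N.
  by rewrite (card_translations phiK psiK 1) card_SL2 F_card.
have := card_expg_abelian (translations_abelian phiK psiK K_abelian) T_card pq p'm.
set Q := [set _ | _ in _] => Q_le.
have nonpar_le : #|~: [set u : {'SL_2[F]} | parabolic (slmx u)]| <= #|Q|.
  (* Evaluation at 1 maps the q-th powers onto a set containing every nonparabolic u. *)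
  apply: leq_trans (leq_imset_card (fun h : {perm {'SL_2[F]}} => h 1) _).
  apply/subset_leq_card/subsetP=> u; rewrite !inE => /q_power[v <-].
  by apply: imset_f; apply: imset_f; apply: mem_translations.
have := cardsC [set u : {'SL_2[F]} | parabolic (slmx u)].
rewrite card_SL2 F_card.
have := card_parabolic F; rewrite F_card => par_le V_eq.
(* The bounds give q (q^2 - 1) <= 2 q^2 + (q^2 - 1), false for q >= 5. *)
nia.
Qed.
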